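(* Let $(\mathcal L,(\cdot,\cdot),\mathcal H)\in\mathcal T$ with root system $R$, with the form normalized so that $(\alpha_0,\alpha_0)=1$ for some $\alpha_0\in R^\times$. Let $\mathcal V_{\mathbb Q}=\mathrm{span}_{\mathbb Q}(R)\subseteq\mathcal H^\star$, $\mathcal V=\mathbb R\otimes_{\mathbb Q}\mathcal V_{\mathbb Q}$, and let $(\cdot,\cdot)_{\mathbb R}$ be the real bilinear form on $\mathcal V$ obtained by extending scalars from the (rational-valued) restriction of $(\cdot,\cdot)$ to $\mathcal V_{\mathbb Q}$; identify $\mathcal V_{\mathbb Q}$ with $1\otimes\mathcal V_{\mathbb Q}\subseteq\mathcal V$. Then $\mathcal V$ is finite-dimensional, $(\cdot,\cdot)_{\mathbb R}$ is positive semidefinite, and $(R,(\cdot,\cdot)_{\mathbb R})$ is an extended affine root system in $\mathcal V$.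
   Context: $\mathbb F$ is a field of characteristic $0$. If $V$ is a finite-dimensional space with a non-degenerate symmetric bilinear form and $\alpha\in V^\star$, $t_\alpha$ denotes the unique element of $V$ with $(t_\alpha,v)=\alpha(v)$ for all $v\in V$. A nonzero subalgebra $\mathcal H$ of a Lie algebra $\mathcal L$ is a (split) toral subalgebra if $\mathcal L=\bigoplus_{\alpha\in\mathcal H^\star}\mathcal L_\alpha$, where $\mathcal L_\alpha=\{x\in\mathcal L:[h,x]=\alpha(h)x\ \forall h\in\mathcal H\}$. The class $\mathcal T$ consists of triples $(\mathcal L,(\cdot,\cdot),\mathcal H)$ with: (T1) $\mathcal L$ is a Lie algebra over $\mathbb F$ with a non-degenerate symmetric invariant bilinear form $(\cdot,\cdot)$; (T2) $\mathcal H$ is a finite-dimensional toral subalgebra of $\mathcal L$ and $(\cdot,\cdot)|_{\mathcal H\times\mathcal H}$ is non-degenerate. Put $R=\{\alpha\in\mathcal H^\star:\mathcal L_\alpha\neq0\}$ (root system), transfer the form to $\mathcal H^\star$ by $(\alpha,\beta):=(t_\alpha,t_\beta)$ (with $t_\alpha\in\mathcal H$), and let $R^\times=\{\alpha\in R:(\alpha,\alpha)\ne0\}$, $R^0=\{\alpha\in R:(\alpha,\alpha)=0\}$; (T3) for each $\delta\in R^0$ there are $x\in\mathcal L_\delta$, $y\in\mathcal L_{-\delta}$ with $[x,y]=t_\delta$, and for each $\alpha\in R^\times$ and each $0\ne x\in\mathcal L_\alpha$ there is $y\in\mathcal L_{-\alpha}$ with $[x,y]=t_\alpha$; (T4) for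 $\alpha\in R^\times$ and $x\in\mathcal L_\alpha$, $\mathrm{ad}\,x$ acts locally nilpotently on $\mathcal L$; (T5) (a) $R^\times$ is not a disjoint union of two nonempty subsets orthogonal to each other, (b) for each $\delta\in R^0$ there is $\alpha\in R^\times$ with $\alpha+\delta\in R$; (T6) $\Lambda:=\mathrm{span}_{\mathbb Z}(R^0)$ is a free abelian group of finite rank. Extended affine root system: let $V$ be a nonzero finite-dimensional real vector space with a positive semidefinite symmetric bilinear form $(\cdot,\cdot)$ and $R\subseteq V$ nonempty; put $R^\times=\{\alpha\in R:(\alpha,\alpha)\neq0\}$, $R^0=\{\alpha\in R:(\alpha,\alpha)=0\}$. $R$ is an extended affine root system in $V$ if: (R1) $R=-R$; (R2) $R$ spans $V$; (R3) $R$ is discrete in $V$; (R4) for $\alpha\in R^\times$, $\beta\in R$ there are $d,u\in\mathbb Z_{\ge0}$ with $\{\beta+n\alpha:n\in\mathbb Z\}\cap R=\{\beta-d\alpha,\dots,\beta+u\alpha\}$ and $d-u=2(\beta,\alpha)/(\alpha,\alpha)$; (R5) (a) $R^\times$ is not a disjoint union of two nonempty mutually orthogonal subsets, (b) for each $\delta\in R^0$ there is $\alpha\in R^\times$ with $\alpha+\delta\in R$. *)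

(* Defs.v *)
From HB Require Import structures.
From mathcomp Require Import all_boot all_order all_algebra.
From mathcomp Require Import Rstruct.
Set Implicit Arguments. Unset Strict Implicit. Unset Printing Implicit Defensive.
Import Order.TTheory GRing.Theory Num.Theory.
Local Open Scope ring_scope.

Notation Real := Rdefinitions.R.

Section LieSetting.
Variables (F : fieldType) (L : lmodType F) (br : L -> L -> L) (form : L -> L -> F).

Definition lie_bracket : Prop :=
  [/\ forall (a : F) (x y z : L), br (a *: x + y) z = a *: br x z + br y z,
      forall (a : F) (x y z : L), br x (a *: y + z) = a *: br x y + br x z,
      forall x : L, br x x = 0 &
      forall x y z : L, br x (br y z) + br y (br z x) + br z (br x y) = 0].

Definition nondeg_sym_invariant_form : Prop :=
  [/\ forall (a : F) (x y z : L), form (a *: x + y) z = a * form x z + form y z,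
      forall x y : L, form x y = form y x,
      forall x y z : L, form (br x y) z = form x (br y z) &
      forall x : L, (forall y : L, form x y = 0) -> x = 0].

Variables (k : nat) (b : 'I_k -> L).
(* H = span of the family b (a basis of H); elements of H are hb c. *)
Definition hb (c : 'rV[F]_k) : L := \sum_(i < k) c 0 i *: b i.
Definition inH (h : L) : Prop := exists c : 'rV[F]_k, h = hb c.

(* H^* is identified with 'rV[F]_k: alpha is determined by its values
   alpha 0 i on the basis vectors b i. *)
Definition evalH (alpha c : 'rV[F]_k) : F := \sum_(i < k) alpha 0 i * c 0 i.

Definition wsp (alpha : 'rV[F]_k) (x : L) : Prop :=
  forall c : 'rV[F]_k, br (hb c) x = evalH alpha c *: x.

Definition toral_T2 : Prop :=
  [/\ (0 < k)%N,
      forall c : 'rV[F]_k, hb c = 0 -> c = 0,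
      forall i j : 'I_k, inH (br (b i) (b j)),
      (
      forall x : L, exists s : seq ('rV[F]_k * L),
          (forall p, p \in s -> wsp p.1 p.2) /\ x = \sum_(p <- s) p.2) /\
      (forall s : seq ('rV[F]_k * L), uniq (map fst s) ->
          (forall p, p \in s -> wsp p.1 p.2) -> \sum_(p <- s) p.2 = 0 ->
          forall p, p \in s -> p.2 = 0) &
      forall c : 'rV[F]_k, (forall c' : 'rV[F]_k, form (hb c) (hb c') = 0) -> c = 0].

Definition gramH : 'M[F]_k := \matrix_(i, j) form (b i) (b j).

(* coordinates of t_alpha : the unique element of H with (t_alpha, h) = alpha(h)
   (well defined once gramH is invertible, i.e. the form on H non-degenerate) *)
Definition tc (alpha : 'rV[F]_k) : 'rV[F]_k := alpha *m invmx gramH.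
Definition t_ (alpha : 'rV[F]_k) : L := hb (tc alpha).

Definition ipH (alpha beta : 'rV[F]_k) : F := form (t_ alpha) (t_ beta).

Definition isroot (alpha : 'rV[F]_k) : Prop := exists x : L, x <> 0 /\ wsp alpha x.
Definition nonisoroot (alpha : 'rV[F]_k) : Prop := isroot alpha /\ ipH alpha alpha <> 0.
Definition isoroot (alpha : 'rV[F]_k) : Prop := isroot alpha /\ ipH alpha alpha = 0.

Definition axiom_T3 : Prop :=
  (forall delta, isoroot delta ->
     exists x y : L, [/\ wsp delta x, wsp (- delta) y & br x y = t_ delta]) /\
  (forall alpha, nonisoroot alpha -> forall x : L, wsp alpha x -> x <> 0 ->
     exists y : L, wsp (- alpha) y /\ br x y = t_ alpha).

Definition axiom_T4 : Prop :=
  forall alpha, nonisoroot alpha -> forall x : L, wsp alpha x ->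
    forall y : L, exists n : nat, iter n (br x) y = 0.

Definition axiom_T5 : Prop :=
  (forall A B : 'rV[F]_k -> Prop,
     (forall a, nonisoroot a <-> A a \/ B a) ->
     (forall a, ~ (A a /\ B a)) ->
     (forall a c, A a -> B c -> ipH a c = 0) ->
     (forall a, ~ A a) \/ (forall a, ~ B a)) /\
  (forall delta, isoroot delta -> exists alpha, nonisoroot alpha /\ isroot (alpha + delta)).

Definition Zspan_root0 (lam : 'rV[F]_k) : Prop :=
  exists (p : nat) (z : 'I_p -> int) (d : 'I_p -> 'rV[F]_k),
    (forall i, isoroot (d i)) /\ lam = \sum_(i < p) d i *~ z i.

Definition axiom_T6 : Prop :=
  exists (m : nat) (e : 'I_m -> 'rV[F]_k),
    (forall z : 'I_m -> int, \sum_(i < m) e i *~ z i = 0 -> forall i, z i = 0) /\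
    (forall lam, Zspan_root0 lam <-> exists z : 'I_m -> int, lam = \sum_(i < m) e i *~ z i).

Definition class_T : Prop :=
  [/\ [pchar F] =i pred0, lie_bracket, nondeg_sym_invariant_form, toral_T2 &
      [/\ axiom_T3, axiom_T4, axiom_T5 & axiom_T6]].

Definition Qspan_root (v : 'rV[F]_k) : Prop :=
  exists (p : nat) (q : 'I_p -> rat) (a : 'I_p -> 'rV[F]_k),
    (forall i, isroot (a i)) /\ v = \sum_(i < p) ratr (q i) *: a i.

End LieSetting.

Section EARS.
Variable (n : nat).
Definition bil (M : 'M[Real]_n) (x y : 'rV[Real]_n) : Real := (x *m M *m y^T) 0 0.

Definition symmetric_mx (M : 'M[Real]_n) : Prop := M^T = M.
Definition psd (M : 'M[Real]_n) : Prop := forall x : 'rV[Real]_n, 0 <= bil M x x.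

Definition ears (M : 'M[Real]_n) (S : 'rV[Real]_n -> Prop) : Prop :=
  let SX := fun a => S a /\ bil M a a <> 0 in
  let S0 := fun a => S a /\ bil M a a = 0 in
  [/\ (0 < n)%N /\ (exists a, S a),
      (* R1 *) (forall a, S a -> S (- a)) /\
      (* R2 *) forall x : 'rV[Real]_n, exists (p : nat) (c : 'I_p -> Real)
                 (a : 'I_p -> 'rV[Real]_n), (forall i, S (a i)) /\
                 x = \sum_(i < p) c i *: a i,
      (* R3 *) forall a, S a -> exists2 eps : Real, 0 < eps &
                 forall c, S c -> (forall i, `|c 0 i - a 0 i| < eps) -> c = a,
      (* R4 *) (forall a c, SX a -> S c -> exists d u : nat,
                 (forall z : int, S (c + a *~ z) <-> (- (d%:Z) <= z <= u%:Z)) /\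
                 d%:R - u%:R = 2 * bil M c a / bil M a a) &
      (* R5 *) (forall A B : 'rV[Real]_n -> Prop,
                 (forall a, SX a <-> A a \/ B a) ->
                 (forall a, ~ (A a /\ B a)) ->
                 (forall a c, A a -> B c -> bil M a c = 0) ->
                 (forall a, ~ A a) \/ (forall a, ~ B a)) /\
               (forall d, S0 d -> exists a, SX a /\ S (a + d))].
End EARS.

(* Main.v *)
(** Call a root anisotropic if (a, a) <> 0. The sl_2-triples given by (T3) and
    (T4) yield, for an anisotropic root a and a root b, an integer
    p = 2(b, a)/(a, a) and the roots between b and b - pa. The Heisenberg triples
    given by (T3) show that an isotropic root d with (a, d) <> 0 would produce
    infinitely many roots a + nd, which contradicts integrality of
    2(d, a + nd)/(a + nd, a + nd); so isotropic roots are orthogonal to all roots.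

    The integers p are uniformly bounded: if p >= 7 then b - 3a is a root, and the
    integrality of 2(a, b)/(b, b) and of 2(a, b - 3a)/(b - 3a, b - 3a) is
    contradictory. Hence root strings are finite, and the roots form finitely many
    classes modulo the radical. Let B(x, y) be the sum of (x, g)(y, g) over
    representatives g of the anisotropic classes. It is invariant under
    reflections, so by irreducibility B = c (., .) with c > 0 rational, and
    positivity follows. Two anisotropic roots in one class differ by an isotropic
    root, so the roots lie in a finitely generated subgroup by (T6). This gives
    finite dimensionality and, by a common denominator of coordinates,
    discreteness. *)

Require Import Defs.
From HB Require Import structures.
From mathcomp Require Import all_boot all_order all_algebra.
From mathcomp Require Import Rstruct boolp zify ring.
Set Implicit Arguments. Unset Strict Implicit. Unset Printing Implicit Defensive.
Import Order.TTheory GRing.Theory Num.Theory.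
Local Open Scope ring_scope.

(** * The rational numbers inside a field of characteristic 0 *)

Section RatChar0.
Variables (F : fieldType) (charF : [pchar F] =i pred0).

Lemma intr_char0_eq0 (z : int) : (z%:~R == 0 :> F) = (z == 0).
Proof.
have natr0 := (pcharf0P F).1 charF.
by case: z => n; rewrite ?NegzE ?rmorphN ?oppr_eq0 /= natr0.
Qed.

Lemma intr_char0_inj : injective (intr : int -> F).
Proof.
move=> x y /eqP; rewrite -subr_eq0 -rmorphB /= intr_char0_eq0 subr_eq0.
by move/eqP.
Qed.

Lemma natr_char0_neq0 n : n.+1%:R != 0 :> F.
Proof. by rewrite ((pcharf0P F).1 charF). Qed.

(* The library makes [ratr] a morphism into numeric fields only; the unused
   argument carries the hypothesis needed by the instances below. *)
Definition ratrF of [pchar F] =i pred0 : rat -> F := ratr.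
Local Notation ratF := (ratrF charF).

(** [ratr] reads the reduced fraction only. Cross-multiplying turns the claim into an identity
    between integers, which can be checked in [rat]. *)
Lemma ratrF_frac (m d : int) : d != 0 -> ratF (m%:~R / d%:~R) = m%:~R / d%:~R.
Proof.
move=> d0; set x := _ / _ : rat.
have dx0 := denq_neq0 x; apply/eqP.
rewrite /ratrF /ratr eqr_div ?intr_char0_eq0 // -!rmorphM /=; apply/eqP.
congr _%:~R; apply: (@intr_inj rat); rewrite !rmorphM /= numqE /x.
by rewrite mulrAC divfK // intr_eq0.
Qed.

Lemma ratrF_zmod_morphism : zmod_morphism ratF.
Proof.
move=> x y; rewrite -[x]divq_num_den -[y]divq_num_den.
set a := numq x; set c := numq y.
have [b0 d0] := (denq_neq0 x, denq_neq0 y).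
move: (denq x) (denq y) b0 d0 => b d b0 d0.
have -> : a%:~R / b%:~R - c%:~R / d%:~R = (a * d - c * b)%:~R / (b * d)%:~R :> rat.
  by rewrite rmorphB !rmorphM /=; field; rewrite !intr_eq0 b0 d0.
rewrite !ratrF_frac ?mulf_neq0 // rmorphB !rmorphM /=.
by field; rewrite !intr_char0_eq0 b0 d0.
Qed.

Lemma ratrF_monoid_morphism : monoid_morphism ratF.
Proof.
split=> [|x y]; first by rewrite /ratrF /ratr divr1.
rewrite -[x]divq_num_den -[y]divq_num_den.
rewrite mulf_div -!rmorphM /= !ratrF_frac ?mulf_neq0 ?denq_neq0 //.
by rewrite mulf_div -!rmorphM.
Qed.

HB.instance Definition _ := GRing.isZmodMorphism.Build rat F ratF
  ratrF_zmod_morphism.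
HB.instance Definition _ := GRing.isMonoidMorphism.Build rat F ratF
  ratrF_monoid_morphism.

End RatChar0.

(** * Weight spaces, the transferred form and ladder computations *)

Section Lie.
Variables (F : fieldType) (L : lmodType F) (br : L -> L -> L).
Variables (form : L -> L -> F) (k : nat) (b : 'I_k -> L).
Hypothesis charF : [pchar F] =i pred0.
Hypothesis lieP : lie_bracket br.
Hypothesis formP : nondeg_sym_invariant_form br form.
Hypothesis formH_nondeg : forall c : 'rV[F]_k,
  (forall c', form (hb b c) (hb b c') = 0) -> c = 0.

Local Notation V := 'rV[F]_k.
Local Notation G := (gramH form b).
Local Notation ip := (ipH form b).
Local Notation wsp := (wsp br b).
Local Notation isroot := (isroot br b).
Local Notation nonisoroot := (nonisoroot br form b).
Local Notation isoroot := (isoroot br form b).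
Local Notation t_ := (t_ form b).

Lemma br_linearr x : linear (br x).
Proof. by move=> a y z; case: lieP => _ ->. Qed.
HB.instance Definition _ x :=
  GRing.isLinear.Build F L L _ (br x) (br_linearr x).

Lemma brZl a x y : br (a *: x) y = a *: br x y.
Proof.
case: lieP => brl _ _ _.
have b0 : br 0 y = 0 by have := brl (-1) 0 0 y; rewrite scaler0 addr0 scaleN1r addNr.
by have := brl a x 0 y; rewrite !addr0 b0 addr0.
Qed.

Lemma brDl x y z : br (x + y) z = br x z + br y z.
Proof. by case: lieP => brl _ _ _; have := brl 1 x y z; rewrite !scale1r. Qed.

Lemma brC x y : br x y = - br y x.
Proof.
case: lieP => _ _ brx _; apply/eqP; rewrite -addr_eq0; apply/eqP.
by have := brx (x + y); rewrite brDl !linearD /= !brx add0r addr0.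
Qed.

Lemma br_derivation h x y : br h (br x y) = br (br h x) y + br x (br h y).
Proof.
case: lieP => _ _ _ jac; have := jac h x y.
rewrite (brC y h) raddfN /= (brC y (br h x)) => /eqP.
by rewrite subr_eq0 => /eqP <-; rewrite subrK.
Qed.

Lemma form_suml (I : finType) (c : I -> F) (x : I -> L) y :
  form (\sum_i c i *: x i) y = \sum_i c i * form (x i) y.
Proof.
case: formP => fl _ _ _.
have f0 : form 0 y = 0.
  by have := fl (-1) 0 0 y; rewrite scaler0 addr0 mulN1r addNr.
elim/big_rec2: _ => [|i a s _ <-]; first exact: f0.
exact: fl.
Qed.

Lemma formC x y : form x y = form y x.
Proof. by case: formP => _ ->. Qed.

Lemma form_hb c c' : form (hb b c) (hb b c') = (c *m G *m c'^T) 0 0.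
Proof.
rewrite form_suml !mxE.
under eq_bigr do rewrite formC form_suml big_distrr /=.
rewrite exchange_big /=; apply: eq_bigr => i _; rewrite !mxE big_distrl /=.
by apply: eq_bigr => j _; rewrite !mxE formC mulrCA mulrC -mulrA.
Qed.

Lemma gramH_tr : G^T = G.
Proof. by apply/matrixP=> i j; rewrite !mxE formC. Qed.

Lemma gramH_unit : G \in unitmx.
Proof.
rewrite -row_free_unit; apply: inj_row_free => c cG0; apply: formH_nondeg => c'.
by rewrite form_hb cG0 mul0mx mxE.
Qed.

Lemma ipHE (x y : V) : ip x y = (x *m invmx G *m y^T) 0 0.
Proof.
rewrite /ipH form_hb /tc mulmxKV ?gramH_unit // trmx_mul trmx_inv gramH_tr.
by rewrite mulmxA.
Qed.

Lemma ipHC x y : ip x y = ip y x.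
Proof. exact: formC. Qed.

Lemma ipHDr x y z : ip x (y + z) = ip x y + ip x z.
Proof. by rewrite !ipHE linearD /= mulmxDr mxE. Qed.

Lemma ipHZr a x y : ip x (a *: y) = a * ip x y.
Proof. by rewrite !ipHE linearZ /= -scalemxAr mxE. Qed.

Lemma ipHNr x y : ip x (- y) = - ip x y.
Proof. by rewrite -scaleN1r ipHZr mulN1r. Qed.

Lemma ipHMnr x y n : ip x (y *+ n) = ip x y *+ n.
Proof. by rewrite -scaler_nat ipHZr mulr_natl. Qed.

Lemma evalH_tc (x y : V) : evalH y (tc form b x) = ip y x.
Proof.
rewrite ipHC ipHE [RHS]mxE /evalH; apply: eq_bigr => i _.
by rewrite mulrC [y^T _ _]mxE.
Qed.

Lemma evalHD (x y c : V) : evalH (x + y) c = evalH x c + evalH y c.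
Proof. by rewrite /evalH -big_split; apply: eq_bigr => i _; rewrite mxE mulrDl. Qed.

Lemma br_t x y u : wsp y u -> br (t_ x) u = ip y x *: u.
Proof. by move=> ->; rewrite evalH_tc. Qed.

Lemma wsp_br x y u v : wsp x u -> wsp y v -> wsp (x + y) (br u v).
Proof.
move=> xu yv c; rewrite br_derivation xu yv brZl linearZ /= evalHD scalerDl.
by [].
Qed.

Lemma wsp_iter x y u v n :
  wsp x u -> wsp y v -> wsp (y + x *+ n) (iter n (br u) v).
Proof.
move=> xu yv; elim: n => [|n IH]; first by rewrite mulr0n addr0.
by rewrite iterS mulrS addrCA; apply: wsp_br.
Qed.

Lemma isroot_iter x y u v n : wsp x u -> wsp y v -> iter n (br u) v != 0 ->
  isroot (y + x *+ n).
Proof.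
move=> xu yv /eqP nz; exists (iter n (br u) v).
by split=> //; apply: wsp_iter.
Qed.

(* Covers both the [sl_2] ladder ([(x, x) <> 0]) and the Heisenberg one
   ([(x, x) = 0]). *)
Lemma br_ladder x y e f w j :
  wsp x e -> wsp (- x) f -> br e f = t_ x -> wsp y w -> br e w = 0 ->
  br e (iter j.+1 (br f) w) =
    (ip y x *+ j.+1 - ip x x *+ 'C(j.+1, 2)) *: iter j (br f) w.
Proof.
move=> xe xf ef yw ew0.
have step u : br e (br f u) = br (t_ x) u + br f (br e u).
  by rewrite br_derivation ef.
elim: j => [|j IH].
  by rewrite /= step ew0 linear0 addr0 mulr1n subr0 (br_t _ yw).
(* The new summand is the eigenvalue [(y - (j + 1) x, x)] of [t_ x]; these eigenvalues add up to the
   binomial coefficient. *)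
have jyw := wsp_iter j.+1 xf yw.
rewrite iterS step (br_t _ jyw) IH linearZ -iterS -scalerDl; congr (_ *: _).
have binE : 'C(j.+2, 2) = ('C(j.+1, 2) + j.+1)%N by rewrite (binS j.+1) bin1.
rewrite binE; move: 'C(j.+1, 2) => B {binE}.
rewrite mulrnDr ipHC ipHDr ipHMnr ipHNr mulNrn ipHC (mulrS _ j.+1).
by rewrite opprD [LHS]addrACA [X in _ + X = _]addrC.
Qed.

Lemma last_nonzero_iter u v N : v <> 0 -> iter N (br u) v = 0 ->
  exists m, iter m (br u) v <> 0 /\ br u (iter m (br u) v) = 0.
Proof.
elim: N => // N IH v0 /=; have [/(IH v0) //|/eqP nz] := eqVneq (iter N (br u) v) 0.
by exists N.
Qed.

Lemma wsp_nonzero_isroot x u : wsp x u -> u <> 0 -> isroot x.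
Proof. by exists u. Qed.

Lemma mulr2n_char0_eq0 (a : F) : a *+ 2 = 0 -> a = 0.
Proof.
by move/eqP; rewrite -mulr_natr mulf_eq0 (negbTE (natr_char0_neq0 charF 1)) orbF => /eqP.
Qed.

Lemma ipHDl x y z : ip (x + y) z = ip x z + ip y z.
Proof. by rewrite ipHC ipHDr !(ipHC z). Qed.

Lemma ipHZl a x y : ip (a *: x) y = a * ip x y.
Proof. by rewrite ipHC ipHZr ipHC. Qed.

(** * Root strings and orthogonality of isotropic roots *)

Hypothesis T3 : axiom_T3 br form b.
Hypothesis T4 : axiom_T4 br form b.

Lemma t_eq0 x y : t_ x = 0 -> ip y x = 0.
Proof.
rewrite /ipH => ->; case: formP => fl _ _ _.
rewrite formC; have := fl (-1) 0 0 (t_ y).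
by rewrite scaler0 addr0 mulN1r addNr.
Qed.

Lemma t_inj0 x : t_ x = 0 -> x = 0.
Proof.
move=> tx0; have tc0 : tc form b x = 0.
  apply: formH_nondeg => c'; rewrite -[hb b _]/(t_ x) tx0.
  by case: formP => fl _ _ _; have := fl (-1) 0 0 (hb b c');
     rewrite scaler0 addr0 mulN1r addNr.
by rewrite -[x](mulmxKV gramH_unit) -/(tc form b x) tc0 mul0mx.
Qed.

Lemma nonisoroot_triple x : nonisoroot x ->
  exists e f, [/\ wsp x e, wsp (- x) f, br e f = t_ x & f <> 0].
Proof.
move=> nx; have [[e [e0 xe]] xx0] := nx.
have [f [xf ef]] := T3.2 _ nx e xe e0.
exists e, f; split=> // f0; apply: xx0; apply: t_eq0.
by rewrite -ef f0 linear0.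
Qed.

(** The partner vector given by (T3) lies in the weight space of [- x]. It vanishes only if
    [t_ x = 0], that is [x = 0], and then [- x = x]. *)
Lemma isrootN x : isroot x -> isroot (- x).
Proof.
move=> rx; have [xx0|nxx] := eqVneq (ip x x) 0; last first.
  have [e [f [_ xf _ f0]]] := nonisoroot_triple (conj rx (elimN eqP nxx)).
  exact: wsp_nonzero_isroot xf f0.
have [e [f [xe xf ef]]] := T3.1 _ (conj rx xx0).
have [f0|/eqP] := eqVneq f 0; last exact: wsp_nonzero_isroot.
have t0 : t_ x = 0 by rewrite -ef f0 linear0.
suff -> : x = 0 by rewrite oppr0 -(t_inj0 t0).
exact: t_inj0.
Qed.

(* A highest weight vector [w] above [v] generates a string of weights that is
   symmetric about 0 and contains the weight of [v]. *)
Lemma root_string_down x y : nonisoroot x -> isroot y -> exists p : int,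
  ip y x *+ 2 = ip x x * p%:~R /\
  forall j : nat, (j%:Z <= p)%R -> isroot (y - x *+ j).
Proof.
move=> nx [v [v0 yv]]; have [e [f [xe xf ef f0]]] := nonisoroot_triple nx.
have [[_ /eqP xx0] [N eN]] := (nx, T4 nx xe v).
have [m [w0 ew]] := last_nonzero_iter v0 eN.
have zw := wsp_iter m xe yv.
move: w0 ew zw; set w := iter m _ v; set z := y + x *+ m => w0 ew zw.
have nNx : nonisoroot (- x).
  split; first exact: isrootN nx.1.
  by rewrite ipHNr ipHC ipHNr opprK; apply/eqP.
have [N' fN'] := T4 nNx xf w.
have [s [fsw0 ffsw]] := last_nonzero_iter w0 fN'.
(* At the last nonzero vector the ladder coefficient vanishes: [(s + 1)(z, x) = C(s + 1, 2)(x, x)],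
   hence [2(z, x) = s(x, x)]. *)
have /esym/eqP := br_ladder s xe xf ef zw ew.
rewrite iterS ffsw linear0 scaler_eq0 (introF eqP fsw0) orbF.
rewrite subr_eq0 => /eqP zx.
have zx2 : ip z x *+ 2 = ip x x *+ s.
  apply: (mulIf (natr_char0_neq0 charF s)); rewrite !mulr_natr -!mulrnA.
  by rewrite mulnC mulrnA zx -mulrnA mulnC mul_bin_left bin1 subSS subn0.
(* Since [y = z - m x], the integer is [s - 2m], and [y - j x = z - (m + j) x] is reached as long as
   [m + j <= s]. *)
exists (s%:Z - m.*2%:Z); split.
  rewrite mulrzr.
  apply: (addIr (ip x x *+ m.*2)).
  rewrite mulrzBr -!pmulrn subrK -zx2 ipHC [in RHS]ipHC ipHDr ipHMnr mulrnDl.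
  by rewrite -mulrnA muln2.
move=> j; rewrite lerBrDr => jp.
have -> : y - x *+ j = z + (- x) *+ (m + j).
  by rewrite /z mulrnDr !mulNrn addrA addrK.
apply: (isroot_iter xf zw); apply/eqP => it0; apply: fsw0.
have mjs : (m + j <= s)%N by lia.
rewrite -(subnK mjs) iterD it0.
by elim: (_ - _)%N => //= n ->; rewrite linear0.
Qed.

(** Either raising [N] times is possible, or there is a top vector [w]. In the latter case
    [(d, d) = 0] makes the ladder coefficients [(j + 1)(x, d)], never zero, so lowering [w] never
    stops. Which direction occurs is not known, hence the absolute value. *)
Lemma isoroot_string_unbounded d x N : isoroot d -> isroot x -> ip x d <> 0 ->
  exists n : int, (N <= `|n|)%N /\ isroot (x + d *~ n).
Proof.
move=> isod [v [v0 xv]] /eqP xd0.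
have [e [f [de df ef]]] := T3.1 _ isod.
have [eN|/eqP eN] := eqVneq (iter N (br e) v) 0; last first.
  by exists N%:Z; split=> //; exists (iter N (br e) v); split=> //; apply: wsp_iter.
have [m [w0 ew]] := last_nonzero_iter v0 eN.
have zw := wsp_iter m de xv.
move: w0 ew zw; set w := iter m _ v; set z := x + d *+ m => w0 ew zw.
have fw0 j : iter j (br f) w <> 0.
  elim: j => // j IH fj0; have /esym/eqP := br_ladder j de df ef zw ew.
  rewrite fj0 linear0 scaler_eq0 (introF eqP IH) orbF isod.2 mul0rn subr0.
  rewrite ipHC ipHDr ipHMnr isod.2 mul0rn addr0 ipHC -mulr_natr mulf_eq0.
  by rewrite (negbTE xd0) (negbTE (natr_char0_neq0 _ _)).
exists (- N%:Z); split; first by rewrite abszN.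
exists (iter (m + N) (br f) w); split=> //.
have := wsp_iter (m + N) df zw.
by rewrite /z mulrnDr !mulNrn addrA addrK mulrNz.
Qed.

Lemma isoroot_orth_nonisoroot d x : isoroot d -> nonisoroot x -> ip d x = 0.
Proof.
move=> isod nx; have [//|dx0] := eqVneq (ip d x) 0.
have [p0 [dx _]] := root_string_down nx isod.1.
(* The norm of [x + n d] is [(x, x)(1 + n p0)], and [|n| >= 3] ensures [|1 + n p0| > |p0|].
   Integrality for [x + n d] makes the nonzero [p0] a multiple of [1 + n p0], which is
   impossible. *)
have [n [n3 rxn]] : exists n : int, (3 <= `|n|)%N /\ isroot (x + d *~ n).
  by apply: (isoroot_string_unbounded _ isod nx.1); rewrite ipHC; apply/eqP.
have dd0 := isod.2.
have ipn u : ip u (d *~ n) = n%:~R * ip u d by rewrite -scaler_int ipHZr.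
have ipm u : ip (d *~ n) u = n%:~R * ip d u by rewrite -scaler_int ipHZl.
have xd : ip x d *+ 2 = ip x x * p0%:~R by rewrite ipHC.
have xnE : ip (x + d *~ n) (x + d *~ n) = ip x x * (1 + n * p0)%:~R.
  rewrite ipHDr !ipHDl !ipn !ipm dd0 mulr0 mulr0 addr0 [ip d x]ipHC -addrA.
  by rewrite -mulrDr -mulr2n xd rmorphD rmorphM /=; ring.
have xx0 : ip x x != 0 by apply/eqP; exact: nx.2.
have p00 : p0 != 0.
  apply: contraNneq dx0 => p00; apply/eqP/mulr2n_char0_eq0.
  by rewrite dx p00 mulr0.
have p0_lt : (absz p0 < absz (1 + n * p0 : int)%R)%N.
  have : (3 * absz p0 <= absz (n * p0)%R)%N by rewrite abszM leq_mul2r n3 orbT.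
  by move: (n * p0) => a; lia.
have nxn : nonisoroot (x + d *~ n).
  split=> //; apply/eqP; rewrite xnE mulf_neq0 // intr_char0_eq0 //.
  by rewrite -absz_eq0 -lt0n (leq_ltn_trans _ p0_lt).
have [p [dxn _]] := root_string_down nxn isod.1.
have dxE : ip d (x + d *~ n) = ip d x by rewrite ipHDr ipn dd0 mulr0 addr0.
move: dxn; rewrite dxE xnE dx -mulrA => /(mulfI xx0).
rewrite -rmorphM => /(intr_char0_inj charF).
move=> p0E; move: p0_lt; rewrite [X in (absz X < _)%N]p0E abszM.
rewrite ltnNge leq_pmulr // lt0n absz_eq0.
by apply: contraNneq p00 => p_0; rewrite p0E p_0 mulr0.
Qed.

Hypothesis T5 : axiom_T5 br form b.

(** By (T5)(b) an isotropic [x] is the difference of the roots [a + x] and [a]. Both are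
    anisotropic, because [x] is orthogonal to [a], so both are orthogonal to [d]. *)
Lemma isoroot_orth d x : isoroot d -> isroot x -> ip d x = 0.
Proof.
move=> isod rx; have [xx0|/eqP xx0] := eqVneq (ip x x) 0; last first.
  exact: isoroot_orth_nonisoroot.
have [a [na rax]] := T5.2 _ (conj rx xx0).
have ax0 : ip x a = 0 by apply: isoroot_orth_nonisoroot.
suff nax : nonisoroot (a + x).
  have := isoroot_orth_nonisoroot isod nax.
  by rewrite ipHDr (isoroot_orth_nonisoroot isod na) add0r.
split=> //; rewrite ipHDr !ipHDl xx0 ax0 ipHC ax0 !addr0.
exact: na.2.
Qed.


End Lie.

(** * Finite spanning families and rational combinations *)

Lemma spanning_subfamily (F : fieldType) (V : vectType F) (P : V -> Prop) :
  exists s : seq V, (forall x, x \in s -> P x) /\ (forall x, P x -> x \in <<s>>%VS).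
Proof.
(* Induction on a bound for the codimension of the span, which drops whenever a missed point of [P]
   is added. *)
suff H n : forall s : seq V, (forall x, x \in s -> P x) ->
    (\dim {:V} - \dim <<s>> < n)%N ->
  exists s : seq V, (forall x, x \in s -> P x) /\ (forall x, P x -> x \in <<s>>%VS).
  by apply: (H _ [::]) (ltnSn _).
elim: n => // n IH s sP dimn.
have [sfull|/existsNP [x /not_implyP [Px /negP xs]]] :=
  EM (forall x, P x -> x \in <<s>>%VS); first by exists s.
apply: (IH (x :: s)) => [y|]; first by rewrite inE => /predU1P [-> //|/sP].
have lt : (\dim <<s>> < \dim <<x :: s>>)%N.
  rewrite span_cons ltn_neqAle dimvS ?addvSr // andbT.
  apply: contra xs => /eqP dimE.
  have /eqP -> : (<<s>> == <[x]> + <<s>>)%VS by rewrite eqEdim addvSr dimE /=.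
  by rewrite (subvP (addvSl _ _)) ?memv_line.
have := dimvS (subvf <<x :: s>>); lia.
Qed.

Section RationalSpan.
Variables (F : fieldType) (V : lmodType F).
Hypothesis charF : [pchar F] =i pred0.
Local Notation ratF := (ratrF charF).

(** The rational span is handled through coordinate rows, without a vector space structure over
    [rat] on [V]. *)
Definition qcomb n (v : 'I_n -> V) (q : 'rV[rat]_n) : V :=
  \sum_(i < n) ratF (q 0 i) *: v i.

Lemma qcombP n (v : 'I_n -> V) a q r :
  qcomb v (a *: q + r) = ratF a *: qcomb v q + qcomb v r.
Proof.
rewrite /qcomb scaler_sumr -big_split; apply: eq_bigr => i _ /=.
by rewrite !mxE rmorphD rmorphM scalerDl scalerA.
Qed.

Lemma qcombD n (v : 'I_n -> V) q r : qcomb v (q + r) = qcomb v q + qcomb v r.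
Proof. by rewrite -[q in LHS]scale1r qcombP rmorph1 scale1r. Qed.

Lemma qcomb0 n (v : 'I_n -> V) : qcomb v 0 = 0.
Proof. by rewrite /qcomb big1 // => i _; rewrite mxE rmorph0 scale0r. Qed.

Lemma qcombZ n (v : 'I_n -> V) a q : qcomb v (a *: q) = ratF a *: qcomb v q.
Proof. by rewrite -[a *: q]addr0 qcombP qcomb0 addr0. Qed.

Lemma qcombN n (v : 'I_n -> V) q : qcomb v (- q) = - qcomb v q.
Proof. by rewrite -[- q]scaleN1r qcombZ rmorphN1 scaleN1r. Qed.

Lemma qcombMz n (v : 'I_n -> V) q (z : int) : qcomb v (q *~ z) = qcomb v q *~ z.
Proof. by rewrite -[q *~ z]scaler_int qcombZ rmorph_int scaler_int. Qed.

Lemma qcomb_delta n (v : 'I_n -> V) i : qcomb v (delta_mx 0 i) = v i.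
Proof.
rewrite /qcomb (bigD1 i) //= big1 ?addr0 => [|j ji].
  by rewrite mxE !eqxx rmorph1 scale1r.
by rewrite mxE (negbTE ji) rmorph0 scale0r.
Qed.

(** An element of [W] is kept only if it is not a rational combination of those already kept. *)
Lemma rational_basis (W : seq V) : exists n (v : 'I_n -> V),
  [/\ forall i, v i \in W, forall q, qcomb v q = 0 -> q = 0 &
  forall x, x \in W -> exists q, x = qcomb v q].
Proof.
elim: W => [|x W [n [v [vW vfree vspan]]]].
  by exists 0%N, (fun=> 0); split=> [[]|q _|] //; rewrite thinmx0.
have [[q xq]|xv] := EM (exists q, x = qcomb v q).
  exists n, v; split=> // [i|y]; first by rewrite inE vW orbT.
  by rewrite inE => /predU1P [->|/vspan //]; exists q.
pose v' (i : 'I_n.+1) := if unlift ord0 i is Some j then v j else x.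
have v'E q : qcomb v' q = ratF (q 0 ord0) *: x + qcomb v (\row_j q 0 (lift ord0 j)).
  rewrite /qcomb big_ord_recl /v' unlift_none; congr (_ + _).
  by apply: eq_bigr => i _; rewrite liftK mxE.
exists n.+1, v'; split=> [i|q|y].
- rewrite /v'; case: unliftP => [j|] _; last exact: mem_head.
  by rewrite inE vW orbT.
- rewrite v'E; have [q0|q0] := eqVneq (q 0 ord0) 0.
    rewrite q0 rmorph0 scale0r add0r => /vfree /rowP t0.
    apply/rowP => i; rewrite mxE; case: (unliftP ord0 i) => [j|] -> //.
    by have := t0 j; rewrite !mxE.
  move=> /eqP; rewrite addr_eq0 => /eqP xE; case: xv.
  exists (- (q 0 ord0)^-1 *: \row_j q 0 (lift ord0 j)).
  rewrite qcombZ rmorphN fmorphV scaleNr -scalerN -xE scalerA mulVf ?scale1r //.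
  by rewrite fmorph_eq0.
- rewrite inE => /predU1P [->|/vspan [q ->]].
    by exists (delta_mx 0 ord0); rewrite qcomb_delta /v' unlift_none.
  exists (\row_i if unlift ord0 i is Some j then q 0 j else 0).
  rewrite v'E mxE unlift_none rmorph0 scale0r add0r; congr qcomb.
  by apply/rowP => j; rewrite !mxE liftK.
Qed.

(** When [v] is free over the rationals, distinct vectors of this kind differ by at least [1/D] in
    some coordinate; discreteness will come from this. *)
Definition integral_comb n (v : 'I_n -> V) (D : nat) (x : V) :=
  exists2 q : 'rV[rat]_n, x = qcomb v q &
    forall i, D%:R * q 0 i \is a Num.int.

Lemma common_denominator n (v : 'I_n -> V) (W : seq V) :
  (forall x, x \in W -> exists q, x = qcomb v q) ->
  exists2 D : nat, (0 < D)%N & forall x, x \in W -> integral_comb v D x.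
Proof.
elim: W => [|x W IH] WP; first by exists 1%N.
have [|D D0 DP] := IH; first by move=> y yW; apply: WP; rewrite inE yW orbT.
have [q xq] := WP _ (mem_head _ _).
pose E := (\prod_i absz (denq (q 0%R i)))%N.
have E0 : (0 < E)%N by apply: prodn_gt0 => i; rewrite absz_gt0 denq_neq0.
exists (D * E)%N => [|y]; first by rewrite muln_gt0 D0.
rewrite inE => /predU1P [->|/DP [r -> rP]].
  exists q => // i; rewrite natrM -mulrA rpredM ?natr_int //.
  rewrite /E (bigD1 i) //= mulnC natrM -mulrA rpredM ?natr_int //.
  by rewrite natr_absz gtr0_norm ?denq_gt0 // mulrC -numqE intr_int.
by exists r => // i; rewrite mulnC natrM -mulrA rpredM ?natr_int.
Qed.

End RationalSpan.

(** * Abstract root systems: Cartan integers and finite strings *)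

Section RootSystem.
Variables (F : fieldType) (k : nat) (ip : 'rV[F]_k -> 'rV[F]_k -> F).
Variable R : 'rV[F]_k -> Prop.
Hypothesis charF : [pchar F] =i pred0.
Hypothesis ipC : forall x y, ip x y = ip y x.
Hypothesis ipDr : forall x y z, ip x (y + z) = ip x y + ip x z.
Hypothesis ipZr : forall a x y, ip x (a *: y) = a * ip x y.

Local Notation V := 'rV[F]_k.
Definition anisotropic x := R x /\ ip x x <> 0.
Definition isotropic x := R x /\ ip x x = 0.

Hypothesis rootN : forall x, R x -> R (- x).
Hypothesis string_down : forall x y, anisotropic x -> R y -> exists p : int,
  ip y x *+ 2 = ip x x * p%:~R /\
  forall j : nat, (j%:Z <= p)%R -> R (y - x *+ j).
Hypothesis isotropic_orth : forall d x, isotropic d -> R x -> ip d x = 0.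

Lemma ipDl x y z : ip (x + y) z = ip x z + ip y z.
Proof. by rewrite ipC ipDr !(ipC z). Qed.

Lemma ipZl a x y : ip (a *: x) y = a * ip x y.
Proof. by rewrite ipC ipZr ipC. Qed.

Lemma ipNr x y : ip x (- y) = - ip x y.
Proof. by rewrite -scaleN1r ipZr mulN1r. Qed.

Lemma ipNl x y : ip (- x) y = - ip x y.
Proof. by rewrite ipC ipNr ipC. Qed.

Lemma ipz x y (z : int) : ip x (y *~ z) = z%:~R * ip x y.
Proof. by rewrite -scaler_int ipZr. Qed.

Lemma ipzl x y (z : int) : ip (x *~ z) y = z%:~R * ip x y.
Proof. by rewrite ipC ipz ipC. Qed.

Lemma ip_sumr (I : Type) (r : seq I) (P : pred I) (f : I -> V) x :
  ip x (\sum_(i <- r | P i) f i) = \sum_(i <- r | P i) ip x (f i).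
Proof.
elim/big_rec2: _ => [|i y1 y2 _ <-]; last by rewrite ipDr.
by rewrite -[0 : V](scale0r 0) ipZr mul0r.
Qed.

Lemma ip_suml (I : Type) (r : seq I) (P : pred I) (f : I -> V) x :
  ip (\sum_(i <- r | P i) f i) x = \sum_(i <- r | P i) ip (f i) x.
Proof. by rewrite ipC ip_sumr; apply: eq_bigr => i _. Qed.

Lemma anisotropicN x : anisotropic x -> anisotropic (- x).
Proof. by case=> rx nx; split; [exact: rootN|rewrite ipNr ipNl opprK]. Qed.

(** Negative steps come from [string_down] for [- x], whose Cartan integer is [- p]. *)
Lemma root_string x y : anisotropic x -> R y -> exists p : int,
  ip y x *+ 2 = ip x x * p%:~R /\
  forall j : int, (0 <= j <= p) || (p <= j <= 0) -> R (y - x *~ j).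
Proof.
move=> nx ry; have [p [pE pS]] := string_down nx ry.
exists p; split=> // j /orP [/andP [j0 jp]|/andP [pj j0]].
  by case: j j0 jp => // j _ jp; apply: pS.
have [q [qE qS]] := string_down (anisotropicN nx) ry.
have qp : q = - p.
  have /eqP xx0 := nx.2; apply/(intr_char0_inj charF)/(mulfI xx0).
  by move: qE; rewrite !ipNr ipNl opprK mulNrn pE rmorphN mulrN => <-.
have := qS (absz j); rewrite qp mulNrn opprK pmulrn abszE ler0_norm //.
by rewrite mulrNz; apply; rewrite lerN2.
Qed.

Lemma cartan_bound x y : anisotropic x -> R y -> exists p : int,
  [/\ ip y x *+ 2 = ip x x * p%:~R, (`|p| <= 6)%N &
  forall j : int, (0 <= j <= p) || (p <= j <= 0) -> R (y - x *~ j)].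
Proof.
(* An upper bound is enough: the lower bound follows on replacing [x] by [- x]. *)
suff pos : forall x' (p : int), anisotropic x' -> R y ->
   ip y x' *+ 2 = ip x' x' * p%:~R ->
   (forall j : int, (0 <= j <= p) || (p <= j <= 0) -> R (y - x' *~ j)) ->
   (p < 7)%R.
  move=> nx ry; have [p [pE pS]] := root_string nx ry; exists p; split=> //.
  have p7 := pos _ _ nx ry pE pS.
  suff : - p < 7 by lia.
  apply: (pos (- x)) => //; first exact: anisotropicN.
    by rewrite !ipNr ipNl opprK mulNrn pE rmorphN mulrN.
  by move=> j jp; rewrite mulNrz -mulrNz; apply: pS; lia.
move=> {}x p nx ry pE pS; rewrite ltNge; apply/negP => p7.
have /eqP xx0 := nx.2.
have [yy0|/eqP ny] := eqVneq (ip y y) 0.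
  move: pE; rewrite (isotropic_orth (conj ry yy0) nx.1) mul0rn => /esym/eqP.
  by rewrite mulf_eq0 (negbTE xx0) intr_char0_eq0 //=; lia.
have [q [qE _]] := root_string (conj ry ny) nx.1.
(* Put [z = y - 3x]. Its Cartan integer along [x] is [p - 6 > 0], so [z] is not orthogonal to [x]
   and cannot be isotropic. *)
have rz : R (y - x *~ 3) by apply: pS; lia.
have zxE : ip (y - x *~ 3) x *+ 2 = ip x x * (p - 6)%:~R.
  by rewrite ipDl ipNl ipzl mulrnDl pE rmorphB /=; ring.
have zz0 : ip (y - x *~ 3) (y - x *~ 3) <> 0.
  move=> zz0; move: zxE; rewrite (isotropic_orth (conj rz zz0) nx.1) mul0rn.
  move/esym/eqP; rewrite mulf_eq0 (negbTE xx0) intr_char0_eq0 //=.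
  lia.
have [t [tE _]] := root_string (conj rz zz0) nx.1.
have zzE : ip (y - x *~ 3) (y - x *~ 3) = ip y y - ip x x * (3 * (p - 3))%:~R.
  rewrite ipDr !ipDl !ipNl !ipNr !ipz !ipzl (ipC x y).
  have -> : ip x x * (3 * (p - 3))%:~R = (ip y x *+ 2) * 3 - ip x x * 9.
    by rewrite pE rmorphM rmorphB /=; ring.
  by rewrite -mulr_natr; ring.
(* The norms are eliminated from [p(x, x) = q(y, y)], [(p - 6)(x, x) = t(z, z)] and
   [(z, z) = (y, y) - 3(p - 3)(x, x)]. *)
have key : (p - 6) * q = t * (p - 3 * (p - 3) * q).
  have qE' : ip x x * p%:~R = ip y y * q%:~R.
    by rewrite -pE -qE ipC.
  apply/(intr_char0_inj charF)/(mulfI xx0).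
  rewrite !rmorphM !rmorphB !rmorphM /=.
  move: tE; rewrite ipC zxE zzE rmorphM !rmorphB /= => tE.
  rewrite mulrA tE.
  transitivity ((ip y y * q%:~R) * t%:~R
                - ip x x * 3 * (p%:~R - 3) * q%:~R * t%:~R); first by ring.
  by rewrite -qE'; ring.
have q0 : q != 0.
  apply: contraPneq qE => ->; rewrite mulr0 ipC pE => /eqP.
  rewrite mulf_eq0 (negbTE xx0) intr_char0_eq0 //=; lia.
(* The cofactor of [t] in [key] exceeds the left side in absolute value, which forces [t = 0]; but
   the left side is not zero. *)
have lt : (p - 6) * `|q| < `|p - 3 * (p - 3) * q|.
  have [qpos|qneg] : q >= 1 \/ q <= -1 by lia.
    have : 0 <= (2 * p - 3) * (q - 1) by apply: mulr_ge0; lia.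
    by lia.
  have : 0 <= p * (- 1 - q) by apply: mulr_ge0; lia.
  by lia.
have := congr1 Num.norm key; rewrite !normrM [`|p - 6|]ger0_norm; last by lia.
move=> nE; move: lt; rewrite {}nE ltNge => /negP; apply.
have [t0|t0] := eqVneq t 0.
  by move: key; rewrite t0 mul0r => /eqP; rewrite mulf_eq0 (negbTE q0) orbF; lia.
by rewrite ler_peMl //; lia.
Qed.

(** The Cartan integer of [y + z x] is [p + 2z], and its bound makes the string finite. From the top
    [u] the string reaches down to the reflected position [- p - u], so [p + u <= d]; from the
    bottom it reaches up to [d - p], so [d - p <= u]. Hence [p = d - u], and the string from the top
    fills the interval. *)
Lemma root_string_interval x y : anisotropic x -> R y -> exists d u : nat,
  (forall z : int, R (y + x *~ z) <-> - d%:Z <= z <= u%:Z) /\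
  ip y x *+ 2 = ip x x * (d%:Z - u%:Z)%:~R.
Proof.
move=> nx ry; have /eqP xx0 := nx.2.
have [p [pE p6 _]] := cartan_bound nx ry.
have step (z : int) : R (y + x *~ z) -> (`|p + 2 * z| <= 6)%R /\
    forall j : int, (0 <= j <= p + 2 * z) || (p + 2 * z <= j <= 0) ->
      R (y + x *~ (z - j)).
  move=> rz; have [q [qE q6 qS]] := cartan_bound nx rz.
  have qp : q = p + 2 * z.
    apply/(intr_char0_inj charF)/(mulfI xx0); rewrite -qE ipDl ipzl mulrnDl pE.
    by rewrite rmorphD rmorphM /=; ring.
  rewrite -qp; split; first by lia.
  by move=> j /qS; rewrite mulrzBr addrA.
have exu : exists n : nat, `[< R (y + x *~ n%:Z) >].
  by exists 0%N; apply/asboolP; rewrite mulr0z addr0.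
have exd : exists n : nat, `[< R (y + x *~ (- n%:Z)) >].
  by exists 0%N; apply/asboolP; rewrite mulr0z addr0.
have bu n : `[< R (y + x *~ n%:Z) >] -> (n <= 6)%N.
  by move=> /asboolP /step [+ _]; lia.
have bd n : `[< R (y + x *~ (- n%:Z)) >] -> (n <= 6)%N.
  by move=> /asboolP /step [+ _]; lia.
case: (ex_maxnP exu bu) => u /asboolP ru umax.
case: (ex_maxnP exd bd) => d /asboolP rd dmax.
have umaxz z : R (y + x *~ z) -> z <= u%:Z.
  by case: z => n rn; [rewrite lez_nat; apply/umax/asboolP|].
have dmaxz z : R (y + x *~ z) -> - d%:Z <= z.
  case: z => n rn //; first by lia.
  rewrite NegzE in rn *; rewrite lerN2 lez_nat.
  by apply/dmax/asboolP.
have [[_ su] [_ sd]] := (step _ ru, step _ rd).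
have wu : 0 <= p + 2 * u%:Z.
  rewrite leNgt; apply/negP => wu.
  have /umaxz : R (y + x *~ (u%:Z - -1)) by apply: su; lia.
  by lia.
have du : p = d%:Z - u%:Z.
  have /dmaxz : R (y + x *~ (u%:Z - (p + 2 * u%:Z))) by apply: su; lia.
  have wd : p - 2 * d%:Z <= 0.
    rewrite leNgt; apply/negP => wd.
    have /dmaxz : R (y + x *~ (- d%:Z - 1)) by apply: sd; lia.
    by lia.
  have /umaxz : R (y + x *~ (- d%:Z - (p + 2 * - d%:Z))) by apply: sd; lia.
  by lia.
exists d, u; split; last by rewrite -du.
move=> z; split=> [rz|zdu]; first by rewrite dmaxz // umaxz.
have -> : z = u%:Z - (u%:Z - z) by lia.
by apply: su; lia.
Qed.

(** * Classes of roots modulo the radical, and reflections *)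

Definition congruent x y := forall z, R z -> ip x z = ip y z.

(** Congruence makes the Cartan integer 2, so the first step [y - x] of the string is a root. *)
Lemma congruent_isotropic x y : anisotropic x -> R y -> congruent x y ->
  isotropic (y - x).
Proof.
move=> nx ry xy; have /eqP xx0 := nx.2.
have [p [pE pS]] := string_down nx ry.
have p2 : p = 2.
  apply/(intr_char0_inj charF)/(mulfI xx0); rewrite -pE.
  by rewrite -(xy _ nx.1) mulr_natr.
split; first by apply: (pS 1%N); rewrite p2.
rewrite ipDr !ipDl !ipNl !ipNr opprK -(xy _ ry) -(xy _ nx.1) ipC.
by rewrite -(xy _ nx.1) subrr add0r addNr.
Qed.

Definition refl x y := y - (ip y x *+ 2 / ip x x) *: x.

Lemma ip_refl x y z : anisotropic x -> ip (refl x y) (refl x z) = ip y z.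
Proof.
move=> [_ /eqP xx0]; rewrite /refl ipDr !ipDl !ipNl !ipNr !ipZl !ipZr.
by rewrite (ipC x z); field.
Qed.

Lemma refl_self x : anisotropic x -> refl x x = - x.
Proof.
move=> [_ /eqP xx0]; rewrite /refl -mulr_natr mulrAC divff // mul1r.
by rewrite scaler_nat mulr2n opprD addrA subrr add0r.
Qed.

Lemma reflK x : anisotropic x -> involutive (refl x).
Proof.
move=> nx y; have E : ip (refl x y) x = - ip y x.
  by apply: oppr_inj; rewrite opprK -ipNr -(refl_self nx) ip_refl.
by rewrite {1}/refl E /refl mulNrn mulNr scaleNr opprK subrK.
Qed.

Lemma root_refl x y : anisotropic x -> R y -> R (refl x y).
Proof.
move=> nx ry; have [p [pE pS]] := root_string nx ry; have /eqP xx0 := nx.2.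
rewrite /refl pE mulrAC divff // mul1r scaler_int; apply: pS.
by case/orP: (le_total 0 p) => ->; rewrite lexx ?orbT.
Qed.

Lemma anisotropic_refl x y : anisotropic x -> anisotropic y ->
  anisotropic (refl x y).
Proof. by move=> nx [ry yy]; split; [exact: root_refl|rewrite ip_refl]. Qed.

Lemma refl_congruent x y z : anisotropic x -> congruent y z ->
  congruent (refl x y) (refl x z).
Proof.
move=> nx yz t rt; rewrite -[t](reflK nx) !ip_refl //.
by apply/yz/root_refl.
Qed.

(** [choose] gives the same result on extensionally equal predicates, so congruent anisotropic roots
    get the same representative and classes can be listed as vectors. *)
Definition rep x : V := choose (fun y => `[< anisotropic y /\ congruent x y >]) x.

Lemma repP x : anisotropic x -> anisotropic (rep x) /\ congruent x (rep x).
Proof. 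
move=> nx; apply/asboolP.
by apply: (@chooseP _ (fun y => `[< anisotropic y /\ congruent x y >])); apply/asboolP.
Qed.

Lemma rep_congruent x y : anisotropic x -> anisotropic y -> congruent x y ->
  rep x = rep y.
Proof.
move=> nx ny xy; rewrite /rep.
have PE : (fun z => `[< anisotropic z /\ congruent x z >]) =1
          (fun z => `[< anisotropic z /\ congruent y z >]).
  move=> z; apply/asboolP/asboolP => -[nz xz]; split=> // t rt.
    by rewrite -xy // xz.
  by rewrite xy // xz.
rewrite (eq_choose PE); apply: choose_id; apply/asboolP; split=> // t rt.
by rewrite xy.
Qed.

(* The Cartan integers against a finite spanning set of roots take at most 13
   values each and determine the congruence class. *)
Lemma finite_representatives : exists G : seq V,
  uniq G /\ forall x, x \in G <-> exists2 y, anisotropic y & x = rep y.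
Proof.
have [s [sR sS]] := spanning_subfamily R.
(* A Cartan integer between -6 and 6 is stored with a shift by 6. *)
pose T := {ffun 'I_(size s) -> 'I_13}.
pose code x (f : T) := forall i : 'I_(size s), anisotropic s`_i ->
  ip x s`_i *+ 2 = ip s`_i s`_i * ((f i)%:Z - 6)%:~R.
have codeP x : R x -> exists f, code x f.
  move=> rx; have H (i : 'I_(size s)) : exists c : 'I_13, anisotropic s`_i ->
      ip x s`_i *+ 2 = ip s`_i s`_i * (c%:Z - 6)%:~R.
    have [ni|ni] := EM (anisotropic s`_i); last by exists ord0.
    have [p [pE p6 _]] := cartan_bound ni rx.
    have c13 : (absz (p + 6)%R < 13)%N by lia.
    exists (Ordinal c13) => _; rewrite pE; congr (_ * _%:~R); rewrite /=; lia.
  have [f fP] := choice H; exists (finfun f) => i ni; rewrite ffunE.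
  exact: fP.
(* Pairings with the spanning family determine those with all roots; isotropic members of [s] pair
   to zero with [x] and [y] alike. *)
have code_congruent x y f : R x -> R y -> code x f -> code y f -> congruent x y.
  move=> rx ry xf yf z /sS /(coord_span (X := in_tuple s)) ->; rewrite !ip_sumr.
  apply: eq_bigr => i _; rewrite !ipZr; congr (_ * _).
  have ri : R s`_i by apply/sR/mem_nth.
  have [ii0|/eqP nii] := eqVneq (ip s`_i s`_i) 0.
    by rewrite ipC [RHS]ipC !(isotropic_orth (conj ri ii0)).
  apply: (mulIf (natr_char0_neq0 charF 1)).
  by rewrite !mulr_natr xf // yf.
(* One root is selected for each code that occurs; 0 is the default for the others and is filtered
   out below unless anisotropic. *)
have H f : exists y, (exists x, anisotropic x /\ code x f) ->
    anisotropic y /\ code y f.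
  by have [[x xf]|nf] := EM (exists x, anisotropic x /\ code x f);
    [exists x|exists 0 => /nf].
have [h hP] := choice H.
exists (undup [seq rep (h f) | f <- enum T & `[< anisotropic (h f) >]]).
split=> [|x]; first exact: undup_uniq.
rewrite mem_undup; split=> [/mapP [f]|[y ny ->]].
  by rewrite mem_filter => /andP [/asboolP nf _] ->; exists (h f).
have [f yf] := codeP y ny.1.
have [nh hf] := hP f (ex_intro _ y (conj ny yf)).
apply/mapP; exists f; first by rewrite mem_filter mem_enum andbT; apply/asboolP.
apply: rep_congruent => //; exact: (code_congruent _ _ f ny.1 nh.1).
Qed.

(** * Irreducibility, rationality and the canonical form *)

Hypothesis connected : forall A B : V -> Prop,
  (forall a, anisotropic a <-> A a \/ B a) ->
  (forall a, ~ (A a /\ B a)) ->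
  (forall a c, A a -> B c -> ip a c = 0) ->
  (forall a, ~ A a) \/ (forall a, ~ B a).

(** If [A] failed at some anisotropic root, [A] and its complement would split the anisotropic roots
    into two nonempty orthogonal parts. *)
Lemma connected_ind (A : V -> Prop) x0 : anisotropic x0 -> A x0 ->
  (forall x y, anisotropic x -> anisotropic y -> A x -> ip x y <> 0 -> A y) ->
  forall x, anisotropic x -> A x.
Proof.
move=> n0 A0 Astep x nx; apply: contrapT => nAx.
have [|||H|H] := connected (A := fun y => anisotropic y /\ A y)
                           (B := fun y => anisotropic y /\ ~ A y).
- by move=> a; split=> [na|[[]|[]] //]; have [|] := EM (A a); [left|right].
- by move=> a [[_ Aa] [_ /(_ Aa)]].
- move=> a c [na Aa] [nc nAc]; have [//|/eqP ac] := eqVneq (ip a c) 0.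
  by case: nAc; apply: (Astep a).
- by case: (H x0).
- by case: (H x).
Qed.

Section Normalized.
Variable x0 : V.
Hypothesis nx0 : anisotropic x0.
Hypothesis x00 : ip x0 x0 = 1.

Local Notation ratF := (ratrF charF).

(** The normalized root starts the induction. If [(x, y)] is nonzero, the relations
    [2(x, y) = p(x, x) = r(y, y)] give [(y, y)] as a rational multiple of [(x, x)]. *)
Lemma norm_rational x : anisotropic x -> exists q : rat, ip x x = ratF q.
Proof.
move: x; apply: (connected_ind (A := fun x => exists q, ip x x = ratF q) nx0)
  => [|x y nx ny [q qE] xy].
  by exists 1; rewrite x00 rmorph1.
have [p [pE _]] := root_string nx ny.1.
have [r [rE _]] := root_string ny nx.1.
have r0 : r != 0.
  apply/eqP => r0; apply: xy; apply: (mulIf (natr_char0_neq0 charF 1)).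
  by rewrite mulr_natr rE r0 mulr0z mulr0 mul0r.
exists (q * p%:~R / r%:~R); rewrite fmorph_div rmorphM /= -qE !rmorph_int.
by rewrite -pE ipC rE mulfK // intr_char0_eq0.
Qed.

Lemma ip_rational x y : R x -> R y -> exists q : rat, ip x y = ratF q.
Proof.
move=> rx ry; have [xx0|/eqP nxx] := eqVneq (ip x x) 0.
  by exists 0; rewrite rmorph0 (isotropic_orth (conj rx xx0)).
have [p [pE _]] := root_string (conj rx nxx) ry.
have [q qE] := norm_rational (conj rx nxx).
exists (q * p%:~R / 2); rewrite fmorph_div rmorphM /= -qE !rmorph_int -pE ipC.
by rewrite (rmorph_nat _ 2) -[ip y x *+ 2]mulr_natr mulfK // (natr_char0_neq0 charF 1).
Qed.

(* The canonical form of the finite quotient root system: it is invariant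
   under reflections, hence proportional to [ip] by irreducibility. *)
Lemma canonical_form : exists N (g : 'I_N -> V) (c : rat),
  [/\ forall i, R (g i), 0 < c &
  forall x y, R x -> R y ->
    \sum_i ip x (g i) * ip y (g i) = ratF c * ip x y].
Proof.
have [G [uG GP]] := finite_representatives.
have GN x : x \in G -> anisotropic x.
  by move=> /GP [y /repP [ny _] ->].
pose B x y := \sum_(g <- G) ip x g * ip y g.
have B_refl a x y : anisotropic a -> R x -> R y -> B (refl a x) (refl a y) = B x y.
  (* [sg] is the action of the reflection on representatives: an involution of [G], so it only
     permutes the summands of [B]. *)
  move=> na rx ry; pose sg g := rep (refl a g).
  have repG x' : x' \in G -> rep x' = x'.
    move=> /GP [z nz ->]; have [nr zr] := repP nz.
    by apply/esym/rep_congruent.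
  have sgG g : g \in G -> sg g \in G.
    by move=> /GN ng; apply/GP; exists (refl a g) => //; apply: anisotropic_refl.
  have sgE z g : R z -> g \in G -> ip (refl a z) g = ip z (sg g).
    move=> rz /GN ng; have nag := anisotropic_refl na ng.
    rewrite -(ip_refl _ _ na) reflK // ipC ((repP nag).2 _ rz) ipC //.
  have sgK : {in G, involutive sg}.
    move=> g gG; have ng := GN g gG; have nag := anisotropic_refl na ng.
    rewrite -[RHS]repG // /sg; apply: rep_congruent => //.
      by apply: anisotropic_refl => //; case: (repP nag).
    rewrite -{2}(reflK na g); apply: refl_congruent => //.
    by move=> z rz; rewrite ((repP nag).2 _ rz).
  have permG : perm_eq (map sg G) G.
    apply: uniq_perm => //; first by rewrite map_inj_in_uniq //; apply: (can_in_inj sgK).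
    move=> z; apply/mapP/idP => [[g gG ->]|zG]; first exact: sgG.
    by exists (sg z); [exact: sgG|rewrite sgK].
  rewrite /B -[RHS](perm_big _ permG) big_map; apply: eq_big_seq => g gG.
  by rewrite !sgE.
have BC x y : B x y = B y x by apply: eq_bigr => g _; rewrite mulrC.
(* The reflection in [a] sends [a] to [- a], so invariance reads [B(a, y) = - B(a, y) + 2(a, y)/(a,
   a) B(a, a)]. *)
have B_root a y : anisotropic a -> R y -> B a y * ip a a = B a a * ip a y.
  move=> na ry; have /eqP aa0 := na.2.
  have := B_refl a a y na na.1 ry; rewrite refl_self //.
  have -> : B (- a) (refl a y) =
      - B a y + (ip a y *+ 2 / ip a a) * B a a.
    rewrite /B mulr_sumr -sumrN -big_split; apply: eq_bigr => g _ /=.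
    by rewrite ipNl /refl ipDl ipNl ipZl (ipC y a); ring.
  move=> E; apply: (mulIf (natr_char0_neq0 charF 1)).
  transitivity ((B a y + B a y) * ip a a); first by ring.
  by rewrite -{1}E; field.
pose c := B x0 x0.
have B_norm x : anisotropic x -> B x x = c * ip x x.
  move: x; apply: (connected_ind (A := fun x => B x x = c * ip x x) nx0).
    by rewrite x00 mulr1.
  (* [B_root] at [x] and at [y], with the symmetry of [B], carries the factor [c] from [x] to [y]
     when [(x, y)] is nonzero. *)
  move=> x y nx ny xE /eqP xy; have /eqP xx0 := nx.2.
  have Bxy : B x y = c * ip x y.
    by apply: (mulIf xx0); rewrite B_root ?xE 1?mulrAC //; exact: ny.1.
  apply: (mulIf xy); rewrite [in LHS]ipC -B_root //; last exact: nx.1.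
  by rewrite BC Bxy mulrAC.
have BE x y : R x -> R y -> B x y = c * ip x y.
  move=> rx ry; have [xx0|/eqP nx] := eqVneq (ip x x) 0.
    have xz z : R z -> ip x z = 0 by apply: isotropic_orth.
    rewrite (xz y) // mulr0 /B big1_seq // => g /andP [_ /GN [rg _]].
    by rewrite xz // mul0r.
  have /eqP xx0 := nx.
  by apply: (mulIf xx0); rewrite B_root ?B_norm 1?mulrAC //.
have gR (i : 'I_(size G)) : R G`_i by have [] := GN _ (mem_nth 0 (ltn_ord i)).
have [u uP] := choice (fun i => ip_rational nx0.1 (gR i)).
exists (size G), (fun i => G`_i), (\sum_i u i ^+ 2).
have cE : c = ratF (\sum_i u i ^+ 2).
  rewrite rmorph_sum /c /B (big_nth 0) big_mkord.
  by apply: eq_bigr => i _; rewrite uP rmorphXn.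
split=> // [|x y rx ry]; last first.
  by rewrite -cE -BE // /B (big_nth 0) big_mkord.
(* Positivity: the representative of [x0] pairs to 1 with [x0], so one of the squares is nonzero. *)
have [nr r0] := repP nx0.
have rG : rep x0 \in G by apply/GP; exists x0.
have iG : (index (rep x0) G < size G)%N by rewrite index_mem.
rewrite (bigD1 (Ordinal iG)) //=; apply: ltr_pwDl; last first.
  by apply: sumr_ge0 => i _; apply: sqr_ge0.
rewrite exprn_even_gt0 //=; apply/eqP => u0.
have := uP (Ordinal iG); rewrite u0 rmorph0 /= nth_index // ipC -r0 ?x00.
  by move/eqP; rewrite oner_eq0.
exact: nx0.1.
Qed.

(** * The rational span of the roots and its generators *)

Definition rational_span (x : V) := exists p (q : 'I_p -> rat) (a : 'I_p -> V),
  (forall i, R (a i)) /\ x = \sum_(i < p) ratr (q i) *: a i.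

Lemma rational_span_ind (P : V -> Prop) : P 0 ->
  (forall q x y, P x -> P y -> P (ratF q *: x + y)) ->
  (forall x, R x -> P x) -> forall x, rational_span x -> P x.
Proof.
move=> P0 PD PR x [p [q [a [ra ->]]]].
apply: (big_ind P) => // [y z Py Pz|i _].
  by rewrite -[y]scale1r -(rmorph1 ratF); apply: PD.
by rewrite -[_ *: _]addr0; apply: PD => //; apply: PR.
Qed.

Lemma rational_span_root x : R x -> rational_span x.
Proof.
move=> rx; exists 1%N, (fun=> 1), (fun=> x); split=> //.
by rewrite big_ord1 (rmorph1 ratF) scale1r.
Qed.

Lemma ip_rational_span x y : rational_span x -> rational_span y ->
  exists q : rat, ip x y = ratF q.
Proof.
move=> sx; move: y; apply: rational_span_ind => [|q y z [a yE] [c zE]|y ry].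
- by exists 0; rewrite rmorph0 -[0 : V](scale0r 0) ipZr mul0r.
- by exists (q * a + c); rewrite ipDr ipZr yE zE rmorphD rmorphM.
move: x sx; apply: rational_span_ind => [|q x z [a xE] [c zE]|x rx].
- by exists 0; rewrite rmorph0 -[0 : V](scale0r 0) ipZl mul0r.
- by exists (q * a + c); rewrite ipDl ipZl xE zE rmorphD rmorphM.
exact: ip_rational.
Qed.

Lemma canonical_form_span N (g : 'I_N -> V) (c : rat) :
  (forall x y, R x -> R y ->
    \sum_i ip x (g i) * ip y (g i) = ratF c * ip x y) ->
  forall x y, rational_span x -> rational_span y ->
    \sum_i ip x (g i) * ip y (g i) = ratF c * ip x y.
Proof.
move=> gP x y sx; move: y; apply: rational_span_ind => [|q y z yE zE|y ry].
- rewrite -[0 : V](scale0r 0) ipZr mul0r mulr0 big1 // => i _.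
  by rewrite ipZl mul0r mulr0.
- rewrite ipDr ipZr mulrDr mulrCA -yE -zE mulr_sumr -big_split.
  by apply: eq_bigr => i _; rewrite ipDl ipZl /=; ring.
move: x sx; apply: rational_span_ind => [|q x z xE zE|x rx].
- by rewrite -[0 : V](scale0r 0) ipZl mul0r mulr0 big1 // => i _; rewrite ipZl !mul0r.
- rewrite ipDl ipZl mulrDr mulrCA -xE -zE mulr_sumr -big_split.
  by apply: eq_bigr => i _; rewrite ipDl ipZl /=; ring.
exact: gP.
Qed.

Hypothesis isotropic_fg : exists m (e : 'I_m -> V),
  (forall i, rational_span (e i)) /\
  (forall d, isotropic d -> exists z : 'I_m -> int, d = \sum_(i < m) e i *~ z i).

(* [x] and [rep x] differ by an isotropic root. *)
Lemma root_generators : exists W : seq V,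
  (forall x, x \in W -> rational_span x) /\
  forall P : V -> Prop, P 0 -> (forall x y, P x -> P y -> P (x - y)) ->
    (forall x, x \in W -> P x) -> forall x, R x -> P x.
Proof.
have [G [_ GP]] := finite_representatives.
have [m [e [eS eP]]] := isotropic_fg.
exists (G ++ codom e); split=> [x|P P0 PB PW x rx].
  rewrite mem_cat => /orP [/GP [y /repP [[ry _] _] ->]|/codomP [i ->] //].
  exact: rational_span_root.
have PN y : P y -> P (- y) by move=> Py; rewrite -sub0r; apply: PB.
have PD y z : P y -> P z -> P (y + z).
  by move=> Py Pz; rewrite -[z]opprK; apply/PB/PN.
have Piso d : isotropic d -> P d.
  move=> /eP [z ->]; apply: (big_ind P) => // i _.
  have Pe : P (e i) by apply: PW; rewrite mem_cat codom_f orbT.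
  have Pn n : P (e i *+ n).
    by elim: n => // n IH; rewrite mulrS; apply: PD.
  by case: (z i) => n; [apply: Pn|rewrite NegzE mulrNz; apply/PN/Pn].
have [xx0|/eqP nxx] := eqVneq (ip x x) 0; first exact: Piso.
have [nr xr] := repP (conj rx nxx).
rewrite -[x](subrK (rep x)); apply: PD.
  apply: Piso; apply: congruent_isotropic => // z rz.
  by rewrite xr.
by apply: PW; rewrite mem_cat; apply/orP; left; apply/GP; exists x.
Qed.

Hypothesis isotropic_shift : forall d, isotropic d ->
  exists a, anisotropic a /\ R (a + d).

(** * The real root system in coordinates *)

Section Realification.
Variables (n : nat) (v : 'I_n -> V) (Qg : 'M[rat]_n).
Hypothesis vS : forall i, rational_span (v i).
Hypothesis vfree : forall q, qcomb charF v q = 0 -> q = 0.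
Hypothesis vspan : forall x, rational_span x -> exists q, x = qcomb charF v q.
Hypothesis QgE : forall i j, ratF (Qg i j) = ip (v i) (v j).

Local Notation qcomb := (qcomb charF v).
Local Notation toR := (map_mx (ratr : rat -> Real)).
Local Notation M := (toR Qg).

Definition realified_root (x : 'rV[Real]_n) := exists (a : V) (q : 'rV[rat]_n),
  [/\ R a, a = \sum_(i < n) ratr (q 0 i) *: v i & x = toR q].
Local Notation S := realified_root.

Lemma qcomb_inj : injective qcomb.
Proof.
move=> q r qr; apply/eqP; rewrite -subr_eq0; apply/eqP/vfree.
by rewrite qcombD qcombN qr subrr.
Qed.

Lemma toR_inj m p : injective (map_mx (ratr : rat -> Real) : 'M_(m, p) -> 'M_(m, p)).
Proof. exact: map_mx_inj. Qed.

Lemma realified_rootE q : S (toR q) <-> R (qcomb q).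
Proof.
split=> [[a [r [+ aE /toR_inj ->]]]|rq]; first by rewrite aE.
by exists (qcomb q), q.
Qed.

Lemma realified_rootP x : S x -> exists2 q, x = toR q & R (qcomb q).
Proof. by move=> [a [q [ra aE ->]]]; exists q => //; move: ra; rewrite aE. Qed.

Lemma root_qcomb x : R x -> exists q, x = qcomb q.
Proof. by move/rational_span_root/vspan. Qed.

Definition gram_rat (q r : 'rV[rat]_n) : rat := (q *m Qg *m r^T) 0 0.

Lemma bil_toR q r : bil M (toR q) (toR r) = ratr (gram_rat q r).
Proof. by rewrite /bil matrix.map_trmx -!map_mxM mxE. Qed.

Lemma ip_qcomb q r : ip (qcomb q) (qcomb r) = ratF (gram_rat q r).
Proof.
rewrite /gram_rat mxE rmorph_sum ip_sumr; apply: eq_bigr => j _.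
rewrite !mxE ip_suml rmorphM rmorph_sum mulr_suml; apply: eq_bigr => i _.
by rewrite ipZl ipZr rmorphM /= QgE; ring.
Qed.

Lemma realified_symmetric : symmetric_mx M.
Proof.
apply/matrixP => i j; rewrite !mxE; congr ratr.
by apply: (fmorph_inj ratF); rewrite /= !QgE ipC.
Qed.

(** With [U] the rational matrix of pairings [(v i, g f)], the canonical form reads [c Qg = U U^T].
    This factorization persists over the reals and writes [c] times the form as a sum of squares. *)
Lemma realified_psd : psd M.
Proof.
move=> x; have [N [g [c [gR c0 gE]]]] := canonical_form.
have [u uP] : exists u : 'I_n * 'I_N -> rat, forall p, ip (v p.1) (g p.2) = ratF (u p).
  have [u uP] := choice (fun p : 'I_n * 'I_N =>
    ip_rational_span (vS p.1) (rational_span_root (gR p.2))).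
  by exists u.
pose U : 'M[rat]_(n, N) := \matrix_(i, f) u (i, f).
have cQg : c *: Qg = U *m U^T.
  apply/matrixP => i j; apply: (fmorph_inj ratF).
  rewrite !mxE rmorphM /= QgE -(canonical_form_span gE) // rmorph_sum.
  by apply: eq_bigr => f _; rewrite !mxE rmorphM /= -!uP.
have cR0 : 0 < (ratr c : Real) by rewrite ltr0q.
rewrite -(pmulr_rge0 _ cR0).
have -> : ratr c * bil M x x = ((x *m toR U) *m (x *m toR U)^T) 0 0.
  rewrite trmx_mul matrix.map_trmx mulmxA -(mulmxA x) -map_mxM -cQg map_mxZ.
  by rewrite -scalemxAr -scalemxAl mxE.
rewrite mxE; apply: sumr_ge0 => f _.
by rewrite [_^T _ _]mxE -expr2 sqr_ge0.
Qed.

(** The coordinate row of any vector in the rational span lies in the real span of [S]; the vectors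
    [v i] then supply the standard basis. *)
Lemma realified_spanning x : exists p (c : 'I_p -> Real) (a : 'I_p -> 'rV[Real]_n),
  (forall i, S (a i)) /\ x = \sum_(i < p) c i *: a i.
Proof.
have [s [sS Ss]] := spanning_subfamily S.
have qs y : rational_span y -> exists2 q, y = qcomb q & toR q \in <<s>>%VS.
  move: y; apply: rational_span_ind => [|a y z [q -> qs] [r -> rs]|y ry].
  - by exists 0; rewrite ?qcomb0 // map_mx0 mem0v.
  - exists (a *: q + r); first by rewrite qcombP.
    by rewrite map_mxD map_mxZ memvD ?memvZ.
  have [q yq] := root_qcomb ry; exists q => //.
  by apply/Ss/realified_rootE; rewrite -yq.
have xs : x \in <<s>>%VS.
  rewrite (row_sum_delta x); apply: memv_suml => i _; apply: memvZ.
  have [q vq] := qs _ (vS i).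
  suff -> : delta_mx 0 i = toR q by [].
  rewrite -(qcomb_inj (_ : qcomb (delta_mx 0 i) = qcomb q)) ?map_delta_mx //.
  by rewrite qcomb_delta.
exists (size s), (fun i => coord (in_tuple s) i x), (fun i => s`_i).
split=> [i|]; first exact/sS/mem_nth.
exact: (coord_span (X := in_tuple s)).
Qed.

(** The finitely many generators have a common denominator [D], hence all roots have coordinates in
    [(1/D) Z]. With [eps = 1/D], [D] times a coordinate difference is an integer of absolute value
    below 1. *)
Lemma realified_discrete a : S a -> exists2 eps : Real, 0 < eps &
  forall c, S c -> (forall i, `|c 0 i - a 0 i| < eps) -> c = a.
Proof.
have [W [WS WP]] := root_generators.
have [D D0 DP] := common_denominator (fun x xW => vspan (WS x xW)).
have DR : forall x, R x -> integral_comb charF v D x.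
  apply: WP => [|x y [q -> qD] [r -> rD]|//].
    by exists 0 => [|i]; rewrite ?qcomb0 // mxE mulr0 rpred0.
  exists (q - r) => [|i]; first by rewrite qcombD qcombN.
  by rewrite !mxE mulrBr rpredB.
have D0R : 0 < D%:R :> Real by rewrite ltr0n.
have D0Q : D%:R != 0 :> rat by rewrite pnatr_eq0 -lt0n.
have SD x : S x -> exists2 q, x = toR q & forall i, D%:R * q 0 i \is a Num.int.
  move=> /realified_rootP [q xq rq]; exists q => //.
  by have [r /qcomb_inj ->] := DR _ rq.
move=> /SD [q -> qD]; exists D%:R^-1; first by rewrite invr_gt0.
move=> _ /SD [r -> rD] dist; congr toR; apply/rowP => i.
have /intrP [z zE] : D%:R * (r 0 i - q 0 i) \is a Num.int by rewrite mulrBr rpredB.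
have := dist i; rewrite !mxE -rmorphB -ratr_norm /= -(ltr_pM2l D0R) mulfV ?gt_eqF //.
rewrite -(ratr_nat Real D) -rmorphM -(rmorph1 (ratr : rat -> Real)) ltr_rat.
rewrite -[X in X * _]ger0_norm ?ler0n // -normrM zE -intr_norm -[1]/(1%:~R) ltr_int.
rewrite -lezD1 => z1; have z0 : z = 0 by lia.
move: zE; rewrite z0 => /eqP; rewrite mulf_eq0 (negbTE D0Q) subr_eq0.
by move/eqP.
Qed.

Lemma realified_anisotropic q :
  S (toR q) /\ bil M (toR q) (toR q) <> 0 <-> anisotropic (qcomb q).
Proof.
rewrite /anisotropic realified_rootE ip_qcomb bil_toR.
split=> -[rq qq]; split=> // /eqP; rewrite fmorph_eq0 => /eqP q0;
  by apply: qq; rewrite q0 rmorph0.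
Qed.

Lemma realified_isotropic q :
  S (toR q) /\ bil M (toR q) (toR q) = 0 <-> isotropic (qcomb q).
Proof.
rewrite /isotropic realified_rootE ip_qcomb bil_toR.
by split=> -[rq /eqP]; rewrite fmorph_eq0 => /eqP ->; rewrite rmorph0.
Qed.

Lemma realified_string a c : S a /\ bil M a a <> 0 -> S c ->
  exists d u : nat,
    (forall z : int, S (c + a *~ z) <-> (- (d%:Z) <= z <= u%:Z)) /\
    d%:R - u%:R = 2 * bil M c a / bil M a a.
Proof.
move=> [Sa aa] /realified_rootP [r -> rr]; move: aa (Sa).
have [q -> rq] := realified_rootP Sa => aa Sq.
have nq : anisotropic (qcomb q) by apply/realified_anisotropic.
have [d [u [duP duE]]] := root_string_interval nq rr.
exists d, u; split=> [z|].
  have -> : toR r + toR q *~ z = toR (r + q *~ z).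
    by rewrite map_mxD -!scaler_int map_mxZ rmorph_int.
  by rewrite realified_rootE qcombD qcombMz.
have /eqP aa0 := aa; apply: (mulIf aa0); rewrite mulfVK // !bil_toR.
move: duE; rewrite !ip_qcomb -(rmorph_int ratF) -rmorphM -rmorphMn.
move/(fmorph_inj ratF)/(congr1 (ratr : rat -> Real)).
rewrite rmorphMn rmorphM rmorph_int rmorphB /= => E.
by rewrite mulr_natl E mulrC.
Qed.

Lemma realified_ears : ears M S.
Proof.
split.
- split; last by have [q xq] := root_qcomb nx0.1; exists (toR q);
    apply/realified_rootE; rewrite -xq; exact: nx0.1.
  (* For [n = 0] the root [x0] would be an empty combination, against [(x0, x0) = 1]. *)
  rewrite lt0n; apply/eqP => n0; have [q xq] := root_qcomb nx0.1.
  move/eqP: x00; rewrite xq /qcomb big1 => [|i]; last first.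
    by have := ltn_ord i; rewrite {2}n0.
  by rewrite -[0 : V](scale0r 0) ipZl mul0r eq_sym oner_eq0.
- split; last exact: realified_spanning.
  move=> a /realified_rootP [q -> rq]; rewrite -map_mxN.
  by apply/realified_rootE; rewrite qcombN; apply: rootN.
- exact: realified_discrete.
- exact: realified_string.
split=> [A B AB disj orth|d [Sd dd]].
  have ABq q : anisotropic (qcomb q) <-> A (toR q) \/ B (toR q).
    by rewrite -AB realified_anisotropic.
  have Aq x : A x -> exists2 q, x = toR q & anisotropic (qcomb q).
    move=> Ax; have [[a [q [ra aE xq]]] xx] := (AB x).2 (or_introl Ax).
    by exists q => //; apply/realified_anisotropic; rewrite -xq; split=> //; exists a, q.
  have Bq x : B x -> exists2 q, x = toR q & anisotropic (qcomb q).
    move=> Ax; have [[a [q [ra aE xq]]] xx] := (AB x).2 (or_intror Ax).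
    by exists q => //; apply/realified_anisotropic; rewrite -xq; split=> //; exists a, q.
  (* The partition is pulled back along coordinates. Since [A] and [B] contain only realified roots,
     emptiness of a pulled-back part gives emptiness of the part itself. *)
  have [|||HA|HB] := @connected (fun x => exists2 q, x = qcomb q & A (toR q))
                               (fun x => exists2 q, x = qcomb q & B (toR q)).
  + move=> x; split=> [nx|[[q -> Ax]|[q -> Bx]]]; try by apply/ABq; [left|right].
    + have [q xq] := root_qcomb nx.1; rewrite xq in nx *.
      by have [Ax|Bx] := (ABq q).1 nx; [left|right]; exists q.
    + by apply/ABq; left.
    + by apply/ABq; right.
  + by move=> x [[q -> Ax] [r /qcomb_inj <- Bx]]; apply: (disj (toR q)).
  + move=> x y [q -> Ax] [r -> Bx]; rewrite ip_qcomb.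
    have /eqP := orth _ _ Ax Bx; rewrite bil_toR fmorph_eq0 => /eqP ->.
    by rewrite rmorph0.
  + left=> x Ax; have [q xq _] := Aq _ Ax; apply: (HA (qcomb q)).
    by exists q; rewrite -?xq.
  + right=> x Ax; have [q xq _] := Bq _ Ax; apply: (HB (qcomb q)).
    by exists q; rewrite -?xq.
have [q xq rq] := realified_rootP Sd; rewrite xq in Sd dd *.
have [a [na rad]] := isotropic_shift ((realified_isotropic q).1 (conj Sd dd)).
have [r ar] := root_qcomb na.1; rewrite ar in na rad.
exists (toR r); split; first exact/realified_anisotropic.
by rewrite -map_mxD; apply/realified_rootE; rewrite qcombD.
Qed.

End Realification.

(** The basis is extracted from the finite list of [root_generators]; this is where finite dimension
    over the rationals comes from. *)
Theorem root_system_ears : exists (n : nat) (v : 'I_n -> V) (Qg : 'M[rat]_n),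
  [/\ forall i, rational_span (v i),
      forall q : 'I_n -> rat, \sum_(i < n) ratr (q i) *: v i = 0 -> forall i, q i = 0,
      forall a, rational_span a ->
        exists q : 'rV[rat]_n, a = \sum_(i < n) ratr (q 0 i) *: v i,
      forall i j, ratr (Qg i j) = ip (v i) (v j) &
      let M := map_mx (ratr : rat -> Real) Qg in
      [/\ symmetric_mx M, psd M & ears M (realified_root v)]].
Proof.
have [W [WS WP]] := root_generators.
have [n [v [vW vfree vspanW]]] := rational_basis charF W.
have vS i := WS _ (vW i).
have vspan x : rational_span x -> exists q, x = qcomb charF v q.
  move: x; apply: rational_span_ind => [|a x y [q ->] [r ->]|].
  - by exists 0; rewrite qcomb0.
  - by exists (a *: q + r); rewrite qcombP.
  apply: WP => // [|x y [q ->] [r ->]]; first by exists 0; rewrite qcomb0.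
  by exists (q - r); rewrite qcombD qcombN.
have [Q QP] := choice (fun p : 'I_n * 'I_n => ip_rational_span (vS p.1) (vS p.2)).
pose Qg := \matrix_(i, j) Q (i, j).
have QgE i j : ratF (Qg i j) = ip (v i) (v j) by rewrite mxE -QP.
exists n, v, Qg; split=> // [q q0 i|].
  have /vfree /rowP /(_ i) : qcomb charF v (\row_i q i) = 0.
    by rewrite /qcomb -[RHS]q0; apply: eq_bigr => j _; rewrite mxE.
  by rewrite !mxE.
split; [exact: realified_symmetric|exact: realified_psd|].
exact: realified_ears.
Qed.

End Normalized.
End RootSystem.

(** * Application to the roots of the Lie algebra *)

Theorem theorem1p6 (F : fieldType) (L : lmodType F) (br : L -> L -> L)
    (form : L -> L -> F) (k : nat) (b : 'I_k -> L) :
  class_T br form b ->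
  (exists alpha0, nonisoroot br form b alpha0 /\ ipH form b alpha0 alpha0 = 1) ->
  exists (n : nat) (v : 'I_n -> 'rV[F]_k) (Qg : 'M[rat]_n),
    [/\ (* v is a Q-basis of V_Q = span_Q(R), so V = R (x)_Q V_Q = 'rV[Real]_n *)
        forall i, Qspan_root br b (v i),
        forall q : 'I_n -> rat, \sum_(i < n) ratr (q i) *: v i = 0 -> forall i, q i = 0,
        forall a, Qspan_root br b a ->
          exists q : 'rV[rat]_n, a = \sum_(i < n) ratr (q 0 i) *: v i,
        (* the form is rational-valued on V_Q, with Gram matrix Qg *)
        forall i j, ratr (Qg i j) = ipH form b (v i) (v j) &
        (* the real extension is symmetric, psd, and R (identified via the
           coordinates in the basis v) is an extended affine root system *)
        let M : 'M[Real]_n := map_mx (ratr : rat -> Real) Qg in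
        let S := fun x : 'rV[Real]_n => exists (a : 'rV[F]_k) (q : 'rV[rat]_n),
            [/\ isroot br b a, a = \sum_(i < n) ratr (q 0 i) *: v i &
                x = map_mx (ratr : rat -> Real) q] in
        [/\ symmetric_mx M, psd M & ears M S]].
Proof.
case=> charF lieP formP [_ _ _ _ formH] [T3 T4 T5 [m [e [_ eE]]]] [x0 [nx0 x00]].
pose D := ipHDr formP formH; pose Z := ipHZr formP formH.
pose N := isrootN lieP formP formH T3.
pose string := root_string_down charF lieP formP formH T3 T4.
pose orth := isoroot_orth charF lieP formP formH T3 T4 T5.
apply: (root_system_ears charF (ipHC b formP) D Z N string orth T5.1 nx0 x00).
- exists m, e; split=> [i|d isod].
    (* Each [e i] is an integer combination of the [e j], so by (T6) it lies in the integral span of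
       the isotropic roots, hence in the rational span. *)
    have [|p [z [d [isod ->]]]] := (eE (e i)).2.
      exists (fun j => (j == i)%:Z); rewrite (bigD1 i) //= eqxx big1 ?addr0 //.
      by move=> j /negbTE ->.
    exists p, (fun j => (z j)%:~R), d; split=> [j|]; first by case: (isod j).
    by apply: eq_bigr => j _; rewrite ratr_int scaler_int.
  apply/eE; exists 1%N, (fun=> 1), (fun=> d); split=> //.
  by rewrite big_ord1.
- exact: T5.2.
Qed.
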